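(* Let $q\in\mathbb{C}$ with $q\neq 0$ and $q\neq 1$, and let $\mathcal{A}$ be a unital associative $\mathbb{C}$-algebra. Let $\Omega_q(\mathcal{A})$ be the universal $q$-differential envelope of $\mathcal{A}$ and let $\mathfrak{T}(\mathcal{A})$ be the tensor algebra over $\mathcal{A}$ of the bimodule $\mathcal{A}\otimes\mathcal{A}$, equipped with the $q$-differential $d_q$ (all as described in the context). Then the canonical homomorphism of graded $q$-differential algebras $\overline{\mathrm{Id}}:\Omega_q(\mathcal{A})\rightarrow\mathfrak{T}(\mathcal{A})$ induced by the identity mapping of $\mathcal{A}$ onto itself (i.e. the unique homomorphism of graded $q$-differential algebras whose restriction to $\mathcal{A}=\Omega_q^0(\mathcal{A})$ is the identity $\mathcal{A}\to\mathcal{A}=\mathfrak{T}^0(\mathcal{A})$) is injective.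
   Context: Tensor products without subscript are over $\mathbb{C}$; $\mathbb{N}=\{0,1,2,\dots\}$. Graded $q$-differential algebra: an $\mathbb{N}$-graded unital associative $\mathbb{C}$-algebra $\mathfrak{A}=\bigoplus_{n\in\mathbb{N}}\mathfrak{A}^n$ equipped with a linear endomorphism $d$, homogeneous of degree $1$, satisfying the $q$-Leibniz rule $d(\alpha\beta)=d(\alpha)\beta+q^a\alpha\, d(\beta)$ for all $\alpha\in\mathfrak{A}^a$, $\beta\in\mathfrak{A}$, and such that $d^N=0$ whenever $q^N=1$ with $N\in\mathbb{N}$, $N\neq 0$. A homomorphism of graded $q$-differential algebras is a homomorphism of unital graded algebras (of degree $0$) commuting with the endomorphisms $d$. Universal property of $\Omega_q(\mathcal{A})$: for every graded $q$-differential algebra $\mathfrak{A}$ and every homomorphism of unital algebras $\varphi:\mathcal{A}\to\mathfrak{A}^0$ there is a unique homomorphism of graded $q$-differential algebras $\bar\varphi:\Omega_q(\mathcal{A})\to\mathfrak{A}$ with $\bar\varphi|_{\mathcal{A}}=\varphi$. Construction of $\Omega_q(\mathcal{A})$. Let $1$ be the unit of $\mathcal{A}$. If $q$ is a root of unity, let $N$ be the smallest strictly positive integer with $q^N=1$; otherwise set $N=\infty$. For each integer $k$ with $1\le k\le N-1$ (all $k\geq 1$ if $N=\infty$) let $d^k(\mathcal{A})$ be a copy of the vector space $\mathcal{A}/\mathbb{C}1$, with canonical projection $d^k:\mathcal{A}\rightarrow d^k(\mathcal{A})$, where $d^1=d$. Let $\mathcal{E}=\bigoplus_{k=1}^{N-1}d^k(\mathcal{A})$,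 graded by giving degree $k$ to $d^k(\mathcal{A})$. Define $d:\mathcal{E}\to\mathcal{E}$ by $d(d^k(x))=d^{k+1}(x)$ for $1\le k$, $k+1\le N-1$, and $d=0$ on $d^{N-1}(\mathcal{A})$ when $N<\infty$. Let $T(\mathcal{E})$ be the tensor algebra (over $\mathbb{C}$) of $\mathcal{E}$, with the induced grading, and extend $d$ to $T(\mathcal{E})$ as the unique extension satisfying the $q$-Leibniz rule. Put $\Omega_q(\mathcal{A})=\mathcal{A}\otimes T(\mathcal{E})$, graded by $\deg(x\otimes t)=\deg(t)$, viewed as a left $\mathcal{A}$-module and right $T(\mathcal{E})$-module in the obvious way; identify $\mathcal{A}$ with $\mathcal{A}\otimes 1$ and $T(\mathcal{E})$ with $1\otimes T(\mathcal{E})$, and set $d(x\otimes t)=1\otimes d(x)t+x\otimes d(t)$. There is a unique associative product on $\Omega_q(\mathcal{A})$ which extends its structure of $(\mathcal{A},T(\mathcal{E}))$-bimodule, makes it a graded algebra, and for which $d$ satisfies the $q$-Leibniz rule; it is determined by $$d^n(x)\,b=d^n(xb)-\sum_{p=1}^n\left[\begin{array}{c}n\\ p\end{array}\right]_q d^{n-p}(x)\,d^p(b),\qquad x,b\in\mathcal{A},\ 1\le n\le N-1,$$ (with $d^0(x)=x$), where $[n]_q=1+q+\dots+q^{n-1}$, $[n!]_q=[1]_q\cdots[n]_q$ (with $[0!]_q=1$) and $\left[\begin{array}{c}n\\ p\end{array}\right]_q=\frac{[n!]_q}{[p!]_q[(n-p)!]_q}$. With this product and $d$, $\Omega_q(\mathcal{A})$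 is a graded $q$-differential algebra. The algebra $\mathfrak{T}(\mathcal{A})=\bigoplus_{n\in\mathbb{N}}\mathfrak{T}^n(\mathcal{A})$ is the unital graded algebra with $\mathfrak{T}^n(\mathcal{A})=\mathcal{A}^{\otimes(n+1)}$ and product $$(x_1\otimes\dots\otimes x_m)(y_1\otimes\dots\otimes y_n)=x_1\otimes\dots\otimes x_{m-1}\otimes x_my_1\otimes y_2\otimes\dots\otimes y_n .$$ In particular $\mathfrak{T}^0(\mathcal{A})=\mathcal{A}$. Set $\tau=1\otimes 1\in\mathfrak{T}^1(\mathcal{A})$. The $q$-differential $d_q$ is the unique linear endomorphism of $\mathfrak{T}(\mathcal{A})$, homogeneous of degree $1$, satisfying the $q$-Leibniz rule and such that $d_q(x)=\tau x-x\tau=1\otimes x-x\otimes 1$ for $x\in\mathcal{A}$ and $d_q(\tau)=\tau^2$; with it $\mathfrak{T}(\mathcal{A})$ is a graded $q$-differential algebra. *)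

(* Defs.v *)
From HB Require Import structures.
From mathcomp Require Import all_boot all_order all_algebra.
From mathcomp Require Import classical_sets reals complex.

Set Implicit Arguments.
Unset Strict Implicit.
Unset Printing Implicit Defensive.

Import GRing.Theory.

Local Open Scope ring_scope.
Local Open Scope classical_set_scope.

Record is_grading (K : nzRingType) (B : algType K) (gr : nat -> set B) :
    Prop := IsGrading {
  gr_zero : forall n, gr n 0;
  gr_linear : forall n (a : K) (x y : B),
    gr n x -> gr n y -> gr n (a *: x + y);
  gr_one : gr 0%N 1;
  gr_mul : forall m n (x y : B), gr m x -> gr n y -> gr (m + n)%N (x * y);
  gr_span : forall x : B, exists (n : nat) (c : nat -> B),
    (forall i, gr i (c i)) /\ x = \sum_(i < n) c i;
  gr_direct : forall (n : nat) (c : nat -> B),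
    (forall i, gr i (c i)) -> \sum_(i < n) c i = 0 ->
    forall i, (i < n)%N -> c i = 0
}.

Record qdga (K : nzRingType) (q : K) := QDGA {
  qdga_alg :> algType K;
  gr : nat -> set qdga_alg;
  diff : {linear qdga_alg -> qdga_alg};
  grP : is_grading gr;
  diff_degree : forall n x, gr n x -> gr n.+1 (diff x);
  diff_leibniz : forall n x y, gr n x ->
    diff (x * y) = diff x * y + q ^+ n *: (x * diff y);
  diff_nilpotent : forall N, (0 < N)%N -> q ^+ N = 1 ->
    forall x, iter N diff x = 0
}.
Arguments gr {K q} _ n.
Arguments diff {K q} _.

Definition qdga_hom (K : nzRingType) (q : K) (B C : qdga q)
    (f : {lrmorphism B -> C}) : Prop :=
  (forall n x, gr B n x -> gr C n (f x)) /\
  (forall x, f (diff B x) = diff C (f x)).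

(* [(Omega, iota)] is the universal q-differential envelope of [A], defined up
   to unique isomorphism by its universal property; [iota] is the
   identification of [A] with the degree 0 part of [Omega]. *)
Definition is_q_envelope (K : nzRingType) (q : K) (A : algType K)
    (Omega : qdga q) (iota : {lrmorphism A -> Omega}) : Prop :=
  (forall x, gr Omega 0 (iota x)) /\
  (forall (B : qdga q) (phi : {lrmorphism A -> B}),
    (forall x, gr B 0 (phi x)) ->
    exists2 f : {lrmorphism Omega -> B},
      qdga_hom f /\ (forall x, f (iota x) = phi x)
    & forall g : {lrmorphism Omega -> B},
        qdga_hom g -> (forall x, g (iota x) = phi x) -> g =1 f).

(* A word [:: x_1; ...; x_m] encodes an m-tuple of vectors; only the values of
   [f] on words of length m matter. *)
Definition multilinear_words (K : nzRingType) (A V : lmodType K) (m : nat)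
    (f : seq A -> V) : Prop :=
  forall (s t : seq A) (a : K) (x y : A), (size s + size t).+1 = m ->
    f (s ++ (a *: x + y) :: t) = a *: f (s ++ x :: t) + f (s ++ y :: t).

(* [T] is the tensor algebra over [A] of the bimodule A (x) A, where
   [w [:: x_1; ...; x_m]], for m > 0, is the pure tensor x_1 (x) ... (x) x_m
   of degree m - 1; the value [w [::]] is irrelevant.
   [tensor_universal] says that [gr T n], with [w] on words of length n + 1, is
   the (n + 1)-st tensor power of [A] over [K]. *)
Record is_tensor_qdga (K : nzRingType) (q : K) (A : algType K)
    (T : qdga q) (w : seq A -> T) : Prop := IsTensorQDGA {
  tensor_degree : forall n s, size s = n.+1 -> gr T n (w s);
  tensor_multilinear : forall n, multilinear_words n.+1 w;
  tensor_universal : forall n (V : lmodType K) (f : seq A -> V),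
    multilinear_words n.+1 f ->
    exists2 g : {linear T -> V},
      forall s, size s = n.+1 -> g (w s) = f s
    & forall h : {linear T -> V},
        (forall s, size s = n.+1 -> h (w s) = f s) ->
        forall t, gr T n t -> h t = g t;
  tensor_one : w [:: 1] = 1;
  tensor_mul : forall (s t : seq A) (x y : A),
    w (rcons s x) * w (y :: t) = w (s ++ (x * y) :: t);
  tensor_diff : forall x : A,
    diff T (w [:: x]) = w [:: 1; 1] * w [:: x] - w [:: x] * w [:: 1; 1];
  tensor_diff_tau : diff T (w [:: 1; 1]) = w [:: 1; 1] ^+ 2
}.

(* Main.v *)
(* In T(A) one has [d^k x = [k]! (tau^k x - tau^(k-1) x tau)] for k > 0. Put
   [theta_k(x) = d^k x / [k]!] in Omega. The rewriting rule
   [tau^r x = theta_r(x) + theta_(r-1)(x) tau + ... + x tau^r] moves every tau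
   of a tensor [x_0 tau x_1 ... tau x_n] to the right; the part free of tau is
   multilinear in the x_i, hence defines a linear map T(A) -> Omega in each
   degree. By the q-Leibniz rule the rewriting is compatible with the product of
   A as long as [[r]! <> 0], which is all that is needed to see that this map is
   a left inverse of the canonical homomorphism on words in the d^k x, and these
   words span Omega by its universal property. *)
Require Import Defs.
From HB Require Import structures.
From mathcomp Require Import all_boot all_order all_algebra.
From mathcomp Require Import boolp classical_sets reals complex.

Set Implicit Arguments.
Unset Strict Implicit.
Unset Printing Implicit Defensive.

Import GRing.Theory.

Local Open Scope ring_scope.

(** * q-integers and q-factorials *)

Definition qint (K : nzRingType) (q : K) (n : nat) : K := \sum_(i < n) q ^+ i.

Definition qfact (K : nzRingType) (q : K) (n : nat) : K :=
  \prod_(i < n) qint q i.+1.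

Section QIntegers.
Context {K : fieldType} (q : K).

Lemma qint1 : qint q 1 = 1.
Proof. by rewrite /qint big_ord1. Qed.

Lemma qintD m n : qint q (m + n) = qint q m + q ^+ m * qint q n.
Proof.
rewrite /qint big_split_ord /=; congr (_ + _).
by rewrite mulr_sumr; apply: eq_bigr => i _; rewrite exprD.
Qed.

Lemma qfact0 : qfact q 0 = 1.
Proof. by rewrite /qfact big_ord0. Qed.

Lemma qfactS n : qfact q n.+1 = qfact q n * qint q n.+1.
Proof. by rewrite /qfact big_ord_recr. Qed.

Lemma qfactS_neq0 n :
  qfact q n.+1 != 0 -> qfact q n != 0 /\ qint q n.+1 != 0.
Proof. by rewrite qfactS mulf_eq0 => /norP. Qed.

Lemma qfact_neq0_le m n : (m <= n)%N -> qfact q n != 0 -> qfact q m != 0.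
Proof.
elim: n => [|n IH]; first by rewrite leqn0 => /eqP->.
rewrite leq_eqVlt => /predU1P[->//|]; rewrite ltnS => /IH{}IH.
by move=> /qfactS_neq0[/IH].
Qed.

(** Some factor [i+1] vanishes, and (q - 1)[i+1] = q^(i+1) - 1. A vanishing factorial thus gives a
    relation to which d^N = 0 applies. *)
Lemma qfact_eq0_root n :
  qfact q n = 0 -> exists2 N, (0 < N <= n)%N & q ^+ N = 1.
Proof.
move=> /eqP/prodf_eq0[i _ /eqP qi0]; exists i.+1; first exact: ltn_ord i.
by apply/eqP; rewrite -subr_eq0 subrX1 -/(qint q i.+1) qi0 mulr0.
Qed.

End QIntegers.

(** * Divided powers of the differential *)

Section QDGATheory.
Context {K : fieldType} {q : K} (B : qdga q).
Implicit Types x y : B.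

Lemma gr_iter_diff n k x : gr B n x -> gr B (n + k) (iter k (diff B) x).
Proof.
move=> grx; elim: k => [|k IH]; first by rewrite addn0.
by rewrite addnS iterS; apply: diff_degree.
Qed.

Lemma diff1 : diff B 1 = 0.
Proof.
have /eqP := @diff_leibniz _ _ B 0 1 1 (gr_one (grP B)).
by rewrite !mulr1 mul1r expr0 scale1r -subr_eq subrr eq_sym => /eqP.
Qed.

Lemma iter_diff0 k : iter k (diff B) 0 = 0.
Proof. by elim: k => //= k ->; rewrite raddf0. Qed.

Lemma iter_diff_eq0 k x : qfact q k = 0 -> iter k (diff B) x = 0.
Proof.
case/qfact_eq0_root => N /andP[N0 leNk] qN.
by rewrite -(subnK leNk) iterD (diff_nilpotent N0 qN) iter_diff0.
Qed.

(* The divided power [d^k x / [k]!]; where [[k]! = 0] the junk value [0^-1 = 0]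
   agrees with [d^k = 0]. *)
Definition divdiff k x : B := (qfact q k)^-1 *: iter k (diff B) x.

Lemma divdiff0 x : divdiff 0 x = x.
Proof. by rewrite /divdiff qfact0 invr1 scale1r. Qed.

Lemma divdiffP k (a : K) x y :
  divdiff k (a *: x + y) = a *: divdiff k x + divdiff k y.
Proof.
have iterP : iter k (diff B) (a *: x + y)
             = a *: iter k (diff B) x + iter k (diff B) y.
  by elim: k => //= k ->; rewrite linearP.
by rewrite /divdiff iterP scalerDr !scalerA mulrC.
Qed.

Lemma divdiff_1 k : divdiff k.+1 1 = 0.
Proof. by rewrite /divdiff iterSr diff1 iter_diff0 scaler0. Qed.

Lemma qfact_divdiff k x :
  qfact q k != 0 -> qfact q k *: divdiff k x = iter k (diff B) x.
Proof. by move=> k0; rewrite scalerA divff ?scale1r. Qed.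

Lemma gr_divdiff k x : gr B 0 x -> gr B k (divdiff k x).
Proof.
move=> grx; rewrite -[divdiff _ _]addr0.
apply: (gr_linear (grP B)); last exact: gr_zero (grP B) _.
by have := gr_iter_diff k grx.
Qed.

Lemma diff_divdiff k x : qfact q k.+1 != 0 ->
  diff B (divdiff k x) = qint q k.+1 *: divdiff k.+1 x.
Proof.
move=> /qfactS_neq0[k0 k1].
by rewrite /divdiff linearZ /= scalerA qfactS invfM mulrCA divff // mulr1.
Qed.

(** Iterated q-Leibniz rule: the divided powers absorb the q-binomial coefficients. The induction
    step applies d and cancels [n+1]. *)
Lemma divdiffM n x y : gr B 0 x -> gr B 0 y -> qfact q n != 0 ->
  divdiff n (x * y) = \sum_(p < n.+1) divdiff (n - p) x * divdiff p y.
Proof.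
move=> grx gry; elim: n => [|n IH] n0.
  by rewrite big_ord1 !divdiff0.
have [n'0 nn0] := qfactS_neq0 n0.
apply: (scalerI nn0); rewrite -diff_divdiff // (IH n'0) linear_sum scaler_sumr.
pose G p := divdiff (n.+1 - p) x * divdiff p y.
transitivity (\sum_(p < n.+1) (qint q (n.+1 - p) *: G p
              + (q ^+ (n.+1 - p.+1) * qint q p.+1) *: G p.+1)).
  apply: eq_bigr => p _.
  have pn : (p <= n)%N by rewrite -ltnS.
  rewrite /= (diff_leibniz (divdiff p y) (gr_divdiff (n - p) grx)).
  rewrite !diff_divdiff ?(qfact_neq0_le _ n0) ?ltnS ?leq_subr //.
  rewrite -subSn // /G subSS -scalerA; congr (_ + _ *: _).
    by rewrite scalerAl.
  by rewrite scalerAr.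
rewrite big_split /=.
(* Each sum gains a term with factor [0] = 0, so both range over the same p; then [n+1-p] +
   q^(n+1-p) [p] = [n+1]. *)
transitivity (\sum_(p < n.+2) qint q (n.+1 - p) *: G p
              + \sum_(p < n.+2) (q ^+ (n.+1 - p) * qint q p) *: G p).
  congr (_ + _).
    by rewrite [RHS]big_ord_recr /= subnn [qint q 0]big_ord0 scale0r addr0.
  by rewrite [RHS]big_ord_recl /= [qint q 0]big_ord0 mulr0 scale0r add0r.
rewrite -big_split /=; apply: eq_bigr => p _.
by rewrite -scalerDl -qintD subnK // -ltnS.
Qed.

End QDGATheory.

(** * The differential subalgebra generated by [A] *)

Section Generation.
Context {K : fieldType} {q : K} {A : algType K}.
Context {Omega : qdga q} (iota : {lrmorphism A -> Omega}).

(** Linear combinations of words in the d^k x, of total degree n. Words grow on the right, which is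
    the shape of the induction in [retraction_homog]. *)
Inductive homog_gen : nat -> Omega -> Prop :=
| Homog1 : homog_gen 0 1
| HomogP n (a : K) b c :
    homog_gen n b -> homog_gen n c -> homog_gen n (a *: b + c)
| HomogD n k b x :
    homog_gen n b -> homog_gen (n + k) (b * iter k (diff Omega) (iota x)).

Definition generated : {pred Omega} := fun b =>
  `[< exists (n : nat) (c : nat -> Omega),
      (forall i, homog_gen i (c i)) /\ b = \sum_(i < n) c i >].

Lemma homog0 n : homog_gen n 0.
Proof.
have := HomogD n 0 Homog1.
by rewrite raddf0 iter_diff0 mulr0 add0n.
Qed.

Lemma homogD n b c : homog_gen n b -> homog_gen n c -> homog_gen n (b + c).
Proof. by move=> hb hc; rewrite -[b]scale1r; apply: HomogP. Qed.

Lemma homogZ n a b : homog_gen n b -> homog_gen n (a *: b).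
Proof. by move=> hb; rewrite -[_ *: _]addr0; apply/HomogP/homog0. Qed.

Lemma homogM m n b c :
  homog_gen m b -> homog_gen n c -> homog_gen (m + n) (b * c).
Proof.
move=> hb; elim=> [|n' a c1 c2 _ h1 _ h2|n' k c' x _ h].
- by rewrite addn0 mulr1.
- by rewrite mulrDr -scalerAr; apply: HomogP.
- by rewrite addnA mulrA; apply: HomogD.
Qed.

Lemma homog_iota x : homog_gen 0 (iota x).
Proof. by have := HomogD 0 x Homog1; rewrite mul1r. Qed.

Lemma homog_generated n b : homog_gen n b -> b \in generated.
Proof.
move=> hb; apply/asboolP; exists n.+1, (fun i => if i == n then b else 0).
split=> [i|]; first by case: eqP => [->//|_]; apply: homog0.
rewrite (bigD1 ord_max) //= eqxx big1 ?addr0 // => i.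
by rewrite -val_eqE /= => /negPf->.
Qed.

Lemma generated_linear : linear_closed generated.
Proof.
move=> a _ _ /asboolP[m [c [hc ->]]] /asboolP[n [e [he ->]]].
(* The two sums may differ in length; [ext] pads them with zeros. *)
pose ext N (f : nat -> Omega) i := if (i < N)%N then f i else 0.
have extE N M (f : nat -> Omega) : (N <= M)%N ->
    \sum_(i < N) f i = \sum_(i < M) ext N f i.
  by move=> leNM; rewrite (big_ord_widen M f leNM) big_mkcond.
apply/asboolP; exists (maxn m n), (fun i => a *: ext m c i + ext n e i); split.
  by move=> i; apply: HomogP; rewrite /ext; case: ifP => _ //; apply: homog0.
rewrite (extE m (maxn m n)) ?leq_maxl // (extE n (maxn m n)) ?leq_maxr //.
by rewrite scaler_sumr -big_split.
Qed.

Lemma generated_sum n (c : 'I_n -> Omega) :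
  (forall i, c i \in generated) -> \sum_i c i \in generated.
Proof.
move=> hc; elim/big_ind: _ => // [|b e hb he].
  exact: homog_generated (homog0 0).
by rewrite -[b]scale1r; apply: generated_linear.
Qed.

Lemma generated_subalg : subalg_closed generated.
Proof.
split; [exact: homog_generated Homog1|exact: generated_linear|].
move=> _ _ /asboolP[m [c [hc ->]]] /asboolP[n [e [he ->]]].
rewrite mulr_suml; apply: generated_sum => i; rewrite mulr_sumr.
by apply: generated_sum => j; apply/homog_generated/homogM.
Qed.

HB.instance Definition _ :=
  GRing.isSubalgClosed.Build K Omega generated generated_subalg.

Definition gen_alg := {b : Omega | b \in generated}.
HB.instance Definition _ := [isSub of gen_alg for @sval _ _].
HB.instance Definition _ := [Choice of gen_alg by <:].
HB.instance Definition _ := [SubChoice_isSubAlgebra of gen_alg by <:].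

Definition gen_val : {lrmorphism gen_alg -> Omega} :=
  HB.pack (val : gen_alg -> Omega)
    (GRing.isLinear.Build K gen_alg Omega _ val
      (fun a u v => linearP val a u v))
    (GRing.isMonoidMorphism.Build gen_alg Omega val
      (conj (rmorph1 val) (rmorphM val))).

Section GenDiff.
Hypothesis iota_gr : forall x, gr Omega 0 (iota x).

Lemma homog_gr n b : homog_gen n b -> gr Omega n b.
Proof.
elim=> [|{}n a c e _ hc _ he|{}n k c x _ hc]; first exact: gr_one (grP Omega).
  exact: gr_linear (grP Omega) _ _ _ _ hc he.
apply: (gr_mul (grP Omega) hc).
by have := gr_iter_diff k (iota_gr x).
Qed.

Lemma homog_diff n b : homog_gen n b -> homog_gen n.+1 (diff Omega b).
Proof.
elim=> [|{}n a c e _ hc _ he|{}n k c x h hc].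
  by rewrite diff1; apply: homog0.
  by rewrite linearP; apply: HomogP.
rewrite (diff_leibniz _ (homog_gr h)); apply: homogD.
  by rewrite -addSn; apply: HomogD.
by rewrite -addnS -iterS; apply/homogZ/HomogD.
Qed.

Lemma diff_generated b : b \in generated -> diff Omega b \in generated.
Proof.
case/asboolP=> n [c [hc ->]]; rewrite linear_sum; apply: generated_sum => i.
exact/homog_generated/homog_diff.
Qed.

Definition gen_gr (n : nat) : set gen_alg := fun u => homog_gen n (val u).

Definition gen_diff_fun (u : gen_alg) : gen_alg :=
  Sub (diff Omega (val u)) (diff_generated (valP u)).

Lemma gen_diff_linear : linear gen_diff_fun.
Proof.
by move=> a u v; apply: val_inj; rewrite /= !linearP.
Qed.

Lemma gen_gr_grading : is_grading gen_gr.
Proof.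
split=> [n|n a u v hu hv||m n u v hu hv|u|n c hc c0 i ltin].
- by rewrite /gen_gr raddf0; apply: homog0.
- by rewrite /gen_gr linearP; apply: HomogP.
- by rewrite /gen_gr rmorph1; apply: Homog1.
- by rewrite /gen_gr rmorphM; apply: homogM.
- have /asboolP[n [c [hc uE]]] := valP u.
  exists n, (fun i => Sub (c i) (homog_generated (hc i))); split=> [i|].
    by rewrite /gen_gr SubK.
  by apply: val_inj; rewrite uE rmorph_sum.
- apply: val_inj; rewrite raddf0.
  apply: (gr_direct (grP Omega) (n := n) (c := fun i => val (c i))) ltin.
    by move=> j; apply: homog_gr (hc j).
  by rewrite -rmorph_sum c0 raddf0.
Qed.

Definition gen_diff : {linear gen_alg -> gen_alg} :=
  HB.pack gen_diff_fun
    (GRing.isLinear.Build K gen_alg gen_alg _ gen_diff_fun gen_diff_linear).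

Definition gen_qdga : qdga q.
Proof.
exists gen_alg gen_gr gen_diff.
- exact: gen_gr_grading.
- by move=> n u; apply: homog_diff.
- move=> n u v hu; apply: val_inj.
  by rewrite /= (diff_leibniz _ (homog_gr hu)).
- move=> N N0 qN u; apply: val_inj; rewrite raddf0.
  rewrite -(diff_nilpotent N0 qN (val u)).
  by elim: {N0 qN}N => //= N <-.
Defined.

End GenDiff.

End Generation.

(** The generated part is itself a graded q-differential algebra, so the universal property maps
    [Omega] into it. Followed by the inclusion, this is an endomorphism fixing [A], hence the
    identity by uniqueness. *)
Lemma envelope_generated (K : fieldType) (q : K) (A : algType K)
    (Omega : qdga q) (iota : {lrmorphism A -> Omega}) :
  is_q_envelope iota -> forall b, b \in generated iota.
Proof.
case=> iota_gr univ b.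
pose G : qdga q := gen_qdga iota_gr.
pose j0 (x : A) : G := Sub (iota x) (homog_generated (homog_iota iota x)).
have j0_linear : linear j0.
  by move=> a x y; apply: val_inj; rewrite /= !linearP.
have j0_monoid : monoid_morphism j0.
  split=> [|x y]; apply: val_inj; first by rewrite /= !rmorph1.
  by rewrite /= !rmorphM.
pose j : {lrmorphism A -> G} := HB.pack j0
  (GRing.isLinear.Build K A G _ j0 j0_linear)
  (GRing.isMonoidMorphism.Build A G j0 j0_monoid).
have [f [[f_gr f_diff] fj] _] :=
  univ G j (fun x => homog_iota iota x : gr G 0 (j x)).
have [e _ e_uniq] := univ Omega iota iota_gr.
pose v : {lrmorphism G -> Omega} := gen_val iota.
have vf_hom : qdga_hom (v \o f : {lrmorphism Omega -> Omega}).
  split=> [n x /f_gr fx|x]; first exact: (homog_gr iota_gr fx).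
  by rewrite /= f_diff.
have id_hom : qdga_hom (idfun : {lrmorphism Omega -> Omega}) by split.
have <- : v (f b) = b.
  transitivity (e b); last by apply/esym/(e_uniq _ id_hom).
  by apply: (e_uniq _ vf_hom) => x; rewrite /= fj.
exact: valP (f b).
Qed.

(** * Powers of tau and iterated differentials in T(A) *)

Section Tensor.
Context {K : fieldType} {q : K} {A : algType K} {T : qdga q} {w : seq A -> T}.
Hypothesis hT : is_tensor_qdga w.

Local Notation tau := (w [:: 1; 1]).

Lemma tensor_mul_tau k x u : tau ^+ k * w (x :: u) = w (nseq k 1 ++ x :: u).
Proof.
elim: k => [|k IH]; first by rewrite mul1r.
rewrite exprS -mulrA IH /=.
(* Exposes the first letter, [x] if k = 0 and 1 otherwise, so that [tensor_mul] applies. *)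
have -> : nseq k 1 ++ x :: u = head x (nseq k 1) :: behead (nseq k 1 ++ x :: u).
  by case: k {IH}.
by rewrite (tensor_mul hT [:: 1]) mul1r.
Qed.

Lemma tensor_mul_alg x y u : w [:: x] * w (y :: u) = w (x * y :: u).
Proof. exact: (tensor_mul hT [::]). Qed.

Lemma gr_tau_exp k : gr T k (tau ^+ k).
Proof.
elim: k => [|k IH]; first exact: gr_one (grP T).
rewrite exprS -[k.+1]add1n; apply: (gr_mul (grP T)) IH.
exact: (tensor_degree hT).
Qed.

Lemma diff_tau_exp k : diff T (tau ^+ k) = qint q k *: tau ^+ k.+1.
Proof.
elim: k => [|k IH]; first by rewrite diff1 /qint big_ord0 scale0r.
rewrite exprS (@diff_leibniz _ _ T 1) ?IH; last exact: (gr_tau_exp 1).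
rewrite (tensor_diff_tau hT) -exprD -scalerAr scalerA -exprS expr1.
by rewrite -[k.+1 in RHS]add1n qintD qint1 expr1 scalerDl scale1r.
Qed.

(** For a = [w [:: x]], d(da) = [2] tau da; hence d^(k+1) a = [k+1]! tau^k da, by induction with [k]
    + q^k [2] = [k+2]. *)
Lemma iter_diff_tensor k x :
  iter k.+1 (diff T) (w [:: x]) =
  qfact q k.+1 *: (tau ^+ k.+1 * w [:: x] - tau ^+ k * w [:: x] * tau).
Proof.
have gr_x : gr T 0 (w [:: x]) by apply: (tensor_degree hT).
set a := w [:: x] in gr_x *.
have da : diff T a = tau * a - a * tau by exact: (tensor_diff hT).
have gr_tau : gr T 1 tau by exact: (gr_tau_exp 1).
have dda : diff T (diff T a) = qint q 2 *: (tau * diff T a).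
  rewrite {1}da raddfB /= (diff_leibniz _ gr_tau) (diff_leibniz _ gr_x).
  rewrite (tensor_diff_tau hT) expr0 scale1r (qintD q 1 1) !qint1 mulr1.
  rewrite scalerDl scale1r [in LHS]addrAC; congr (_ + _).
  by rewrite da mulrBr mulrBl expr2 !mulrA subrK.
elim: k => [|k IH].
  by rewrite qfactS qfact0 qint1 mulr1 scale1r /= expr1 mul1r.
have fold k' : tau ^+ k'.+1 * a - tau ^+ k' * a * tau = tau ^+ k' * diff T a.
  by rewrite da mulrBr exprSr !mulrA.
rewrite iterS IH !fold linearZ /= (diff_leibniz _ (gr_tau_exp k)) dda.
rewrite diff_tau_exp -scalerAl -scalerAr scalerA mulrA -exprSr -scalerDl.
by rewrite -qintD addn2 scalerA -qfactS.
Qed.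

End Tensor.

(** * Normal ordering and the left inverse *)

Section Retraction.
Context {K : fieldType} {q : K} {A : algType K}.
Context {Omega : qdga q} (iota : {lrmorphism A -> Omega}).
Hypothesis iota_gr : forall x, gr Omega 0 (iota x).

Local Notation theta k x := (divdiff k (iota x)).

(* The coefficient of [tau] in the normal form of
   [b tau^r x_1 tau x_2 tau ... x_m tau], for [s = [:: x_1; ...; x_m]]. The
   extra final [tau] makes the recursion uniform. *)
Fixpoint normal_order (r : nat) (s : seq A) (b : Omega) : Omega :=
  if s is x :: s' then
    \sum_(j < r.+1) normal_order j.+1 s' (b * theta (r - j) x)
  else if r == 1%N then b else 0.

Lemma normal_orderP r s (a : K) b c :
  normal_order r s (a *: b + c) = a *: normal_order r s b + normal_order r s c.
Proof.
elim: s r b c => [|x s IH] r b c /=.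
  by case: eqP => // _; rewrite scaler0 addr0.
rewrite scaler_sumr -big_split; apply: eq_bigr => j _ /=.
by rewrite mulrDl -scalerAl IH.
Qed.

HB.instance Definition _ r s :=
  GRing.isLinear.Build K Omega Omega _ (normal_order r s)
    (normal_orderP r s).

Lemma normal_order_multilinear n (b : Omega) :
  multilinear_words n.+1 (fun s => normal_order 0 s b).
Proof.
move=> s t a x y _; elim: s 0%N b => [|z s IH] r b /=.
  rewrite scaler_sumr -big_split; apply: eq_bigr => j _ /=.
  by rewrite linearP divdiffP mulrDr -scalerAr linearP.
by rewrite scaler_sumr -big_split; apply: eq_bigr => j _; rewrite IH.
Qed.

(** As theta_j(1) = 0 for j > 0, tau^r passes the letter 1 unchanged and merges with the tau behind
    it. *)
Lemma normal_order1 r s b : normal_order r (1 :: s) b = normal_order r.+1 s b.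
Proof.
rewrite /= big_ord_recr /= subnn rmorph1 divdiff0 mulr1 big1 ?add0r // => j _.
by rewrite -subnSK // divdiff_1 mulr0 raddf0.
Qed.

Lemma normal_order_nseq1 r k s b :
  normal_order r (nseq k 1 ++ s) b = normal_order (r + k) s b.
Proof.
elim: k r => [|k IH] r; first by rewrite addn0.
by rewrite -addSnnS -IH -normal_order1.
Qed.

(* The identity [tau^k.+1 (x y) = tau^k x tau y + theta_(k.+1)(x) y]. *)
Lemma normal_orderM k x y u b : qfact q k.+1 != 0 ->
  normal_order k.+1 (x * y :: u) b =
  normal_order k [:: x, y & u] b + normal_order 0 (y :: u) (b * theta k.+1 x).
Proof.
move=> k0.
(* Here tau^(k+1) crosses x leaving tau^i, which crosses y leaving tau^j; the tau after y makes it
   tau^(j+1). *)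
pose G i j :=
  normal_order j.+1 u (b * theta (k.+1 - i) x * theta (i - j) y).
transitivity (\sum_(i < k.+2) \sum_(j < k.+2 | (j <= i)%N) G i j).
  (* For fixed j, theta_(k+1-j)(x y) expands by [divdiffM], with i = j + p. *)
  rewrite (exchange_big_dep xpredT) //=; apply: eq_bigr => j _.
  have jk : (j <= k.+1)%N by rewrite -ltnS.
  rewrite rmorphM (divdiffM (iota_gr x) (iota_gr y)); last first.
    by apply: qfact_neq0_le k0; rewrite leq_subr.
  rewrite mulr_sumr linear_sum /= -subSn //.
  rewrite -(big_mkord xpredT (fun p => normal_order j.+1 u
    (b * (theta (k.+1 - j - p) x * theta p y)))).
  rewrite -(big_mkord (fun i => (j <= i)%N) (fun i => G i j)).
  rewrite [RHS](big_cat_nat (n := j)) //=; last exact: leqW.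
  rewrite [X in _ = X + _]big_nat_cond [X in _ = X + _]big1 => [|i]; last first.
    by rewrite ltnNge andbC; case: leqP.
  rewrite add0r -{4}[j : nat]add0n big_addn [RHS]big_mkcond.
  apply: eq_bigr => p _; rewrite leq_addl.
  by rewrite /G addnK -subnDA [(j + p)%N]addnC mulrA.
(* Row i = 0 is the term in theta_(k+1)(x); the rows i > 0 form tau^k x tau y. *)
rewrite big_ord_recl /= addrC; congr (_ + _).
  apply: eq_bigr => i _ /=.
  rewrite (big_ord_widen_cond k.+2 xpredT (fun j => normal_order j.+1 u
     (b * theta (k - i) x * theta (i.+1 - j) y))) //.
  exact: ltn_ord (lift ord0 i).
by rewrite (big_pred1 ord0) => [|j]; rewrite ?leqn0 // big_ord1 /G !subn0.
Qed.

Context {T : qdga q} {w : seq A -> T}.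
Hypothesis hT : is_tensor_qdga w.
Context {Phi : {lrmorphism Omega -> T}}.
Hypothesis Phi_hom : qdga_hom Phi.
Hypothesis Phi_iota : forall x : A, Phi (iota x) = w [:: x].

(** The tail [x :: u] is arbitrary so that the induction can move the last factor of b into the
    tensor. *)
Lemma retraction_homog (g : nat -> {linear T -> Omega}) :
  (forall n s, size s = n.+1 -> g n (w s) = normal_order 0 s 1) ->
  forall n b, homog_gen iota n b -> forall x u,
    g (n + size u)%N (Phi b * w (x :: u)) = normal_order 0 (x :: u) b.
Proof.
move=> gE n b; elim=> {n b} [|n a b c _ IHb _ IHc|n k b z _ IH] x u.
- by rewrite rmorph1 mul1r gE.
- by rewrite linearP mulrDl -scalerAl [LHS]linearP IHb IHc -normal_orderP.
have Phi_iter : Phi (iter k (diff Omega) (iota z)) = iter k (diff T) (w [:: z]).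
  by rewrite -Phi_iota; elim: k => //= k <-; apply: (proj2 Phi_hom).
rewrite rmorphM [LHS]/= Phi_iter.
case: k Phi_iter => [|k] _.
  rewrite addn0 -mulrA tensor_mul_alg // IH /= !big_ord1 !divdiff0.
  by rewrite rmorphM mulrA.
(* If [k+1]! = 0, then d^(k+1) = 0 in both algebras. *)
have [k0|k0] := eqVneq (qfact q k.+1) 0.
  by rewrite !iter_diff_eq0 // !mulr0 mul0r !raddf0.
have {}IH m s : size s = m.+1 ->
    g (n + m)%N (Phi b * w s) = normal_order 0 s b.
  by case: s => [//|y s] [<-].
have tauw : w [:: 1; 1] * w (x :: u) = w [:: 1, x & u].
  exact: tensor_mul_tau hT 1 x u.
(* The image of d^(k+1) z yields [k+1]! times a difference of two tensors. After normal ordering,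
   [normal_orderM] leaves theta_(k+1)(z), and the factorial restores d^(k+1) z. *)
rewrite (iter_diff_tensor hT) -scalerAr -scalerAl linearZ mulrBr mulrBl.
rewrite -!mulrA tauw !(tensor_mul_alg hT) !(tensor_mul_tau hT) mulr1.
rewrite linearB -addnA !IH; last 2 first.
- by rewrite size_cat size_nseq /= !addnS.
- by rewrite size_cat size_nseq /= addnS.
rewrite !normal_order_nseq1 !add0n.
rewrite normal_orderM // addrAC subrr add0r.
by rewrite -linearZ /= scalerAr qfact_divdiff.
Qed.

End Retraction.

Theorem proposition1 (R : realType) (q : R[i]) (hq0 : q <> 0) (hq1 : q <> 1)
  (A : algType R[i])
  (Omega : qdga q) (iota : {lrmorphism A -> Omega})
  (hOmega : is_q_envelope iota)
  (T : qdga q) (w : seq A -> T) (hT : is_tensor_qdga w)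
  (Phi : {lrmorphism Omega -> T}) (hPhi : qdga_hom Phi)
  (hPhiA : forall x : A, Phi (iota x) = w [:: x]) :
  injective Phi.
Proof.
have iota_gr := proj1 hOmega.
have /choice[g gE] n : exists g : {linear T -> Omega},
    forall s, size s = n.+1 -> g (w s) = normal_order iota 0 s 1.
  have [g gE _] := tensor_universal hT (normal_order_multilinear iota (n:=n) 1).
  by exists g.
apply: raddf_inj => b Phi_b.
have /asboolP[n [c [hc bE]]] := envelope_generated hOmega b.
rewrite bE big1 // => i _.
(* [Phi] preserves degrees and the sum in [T] is direct, so each component of b lies in the
   kernel. *)
have Phi_c : Phi (c i) = 0.
  apply: (gr_direct (grP T) (c := fun j => Phi (c j))) (ltn_ord i).
    by move=> j; apply: (proj1 hPhi); apply: homog_gr (hc j).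
  by rewrite -[RHS]Phi_b bE raddf_sum.
(* The one-letter tail 1 is the unit of [T], and it supplies the single tau whose coefficient is
   read off: g_i(Phi(c_i)) = c_i. *)
have := retraction_homog iota_gr hT hPhi hPhiA gE (hc i) 1 [::].
rewrite (tensor_one hT) Phi_c mul0r linear0 normal_order1.
exact: esym.
Qed.
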